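(* Let $f$ be a Blaschke function and let $A$ be a bounded operator on the Hardy space $H^2$ such that $f(M_z)A=AM_z$. Then $A=M_\varphi C_f$ for some $\varphi\in H^\infty$. Moreover, $\varphi$ can be chosen such that $$\|\varphi\|_\infty\le\|A\|\sqrt{\|f'\|_\infty}.$$
   Context: $H^2$ is the Hardy space of the open unit disk $\mathbb D$; $H^\infty$ is the algebra of bounded analytic functions on $\mathbb D$ with the supremum norm. A Blaschke function is a finite Blaschke product $f(z)=e^{i\theta}\prod_{j=1}^N\frac{z-a_j}{1-\overline{a_j}z}$ with $N\ge 1$, $\theta\in\mathbb R$, $a_j\in\mathbb D$. $M_\varphi$ is multiplication by $\varphi$ on $H^2$; $f(M_z)=M_f$ is multiplication by $f$; $C_f$ is the (bounded) composition operator $C_f h=h\circ f$ on $H^2$. $\|f'\|_\infty$ is the supremum norm of $f'$ on $\mathbb D$ (equivalently on the unit circle). *)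

(* Defs.v *)
From HB Require Import structures.
From mathcomp Require Import all_boot all_order all_algebra.
From mathcomp Require Import complex ring lra.
From mathcomp Require Import all_classical all_reals all_analysis.

Set Implicit Arguments.
Unset Strict Implicit.
Unset Printing Implicit Defensive.

Import Order.TTheory GRing.Theory Num.Theory.
Import numFieldNormedType.Exports.
Import ComplexField.Normc.
Local Open Scope classical_set_scope.
Local Open Scope ring_scope.
Local Open Scope complex_scope.

(* Without this instance, [R[i]] has no canonical topology; it receives the
   one of the numFieldType [R[i]], so that [derivable] and [derive1] for
   [f : R[i] -> R[i]] refer to complex differentiation. *)
HB.instance Definition _ (R : realType) :=
  NormedModule.copy R[i] (R[i] : numFieldType).

Definition disk (R : realType) : set R[i] := [set z | `|z| < 1].

(* The norm of a normed module over [R[i]] takes its values in [R[i]]; [rnorm]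
   is the same norm as an element of [R]. *)
Definition rnorm (R : realType) (V : normedModType R[i]) (v : V) : R :=
  complex.Re `|v|.

Definition power_series_on_disk (R : realType) (a : nat -> R[i])
    (h : R[i] -> R[i]) : Prop :=
  forall z, disk z -> series (fun n => a n * z ^+ n) @ \oo --> h z.

Definition square_summable (R : realType) (a : nat -> R[i]) : Prop :=
  cvgn (series (fun n => normc (a n) ^+ 2)).

Definition l2norm (R : realType) (a : nat -> R[i]) : R :=
  Num.sqrt (limn (series (fun n => normc (a n) ^+ 2))).

(* A function on the disk is encoded as a function on [R[i]] that vanishes off
   the disk, so that Leibniz equality is equality of functions on the disk. *)
Definition H2pred (R : realType) : {pred R[i] -> R[i]} := fun h =>
  `[< (exists2 a, square_summable a & power_series_on_disk a h) /\
      (forall z, ~ disk z -> h z = 0) >].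

Section SquareSummable.
Variable R : realType.
Implicit Types (a b : nat -> R[i]) (c z : R[i]) (h g : R[i] -> R[i]).

Let sq_ge0 a n : 0 <= normc (a n) ^+ 2. Proof. exact: sqr_ge0. Qed.

Lemma normc_ge0 z : 0 <= normc z.
Proof. by case: z => x y /=; rewrite sqrtr_ge0. Qed.

Lemma normr_normc z : `|z| = (normc z)%:C.
Proof. by rewrite normc_def; case: z. Qed.

Lemma nd_sq a : nondecreasing_seq (series (fun n => normc (a n) ^+ 2)).
Proof.
by apply/nondecreasing_seqP => n; rewrite /series/= big_nat_recr//= lerDl.
Qed.

Lemma sq_sum0 : square_summable (fun=> 0 : R[i]).
Proof.
rewrite /square_summable (_ : series _ = cst 0); first exact: is_cvg_cst.
apply/funext => n; rewrite /series/= big1// => i _.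
by rewrite !expr0n/= addr0 sqrtr0 expr0n.
Qed.

Lemma sq_sumZ c a : square_summable a -> square_summable (fun n => c * a n).
Proof.
move=> sa; rewrite /square_summable.
rewrite (_ : series _ = (fun n => normc c ^+ 2 *
  series (fun n => normc (a n) ^+ 2) n)).
  by apply: is_cvgM => //; exact: is_cvg_cst.
apply/funext => n; rewrite /series/= mulr_sumr.
by apply: eq_bigr => i _; rewrite normcM exprMn.
Qed.

Lemma sq_sumD a b : square_summable a -> square_summable b ->
  square_summable (fun n => a n + b n).
Proof.
move=> sa sb; rewrite /square_summable.
apply: (@series_le_cvg _ _
  (fun n => 2 * (normc (a n) ^+ 2 + normc (b n) ^+ 2))).
- by move=> n; exact: sqr_ge0.
- by move=> n; rewrite mulr_ge0// addr_ge0// sqr_ge0.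
- move=> n; apply: (@le_trans _ _ ((normc (a n) + normc (b n)) ^+ 2)).
    by rewrite lerXn2r ?nnegrE ?addr_ge0 ?normc_ge0// le_normcD.
  rewrite -subr_ge0 (_ : _ - _ = (normc (a n) - normc (b n)) ^+ 2) ?sqr_ge0//.
  by rewrite sqrrD sqrrB mulrDr !mulr_natl !mulr2n; lra.
- rewrite (_ : series _ = (fun n => 2 *
    (series (fun n => normc (a n) ^+ 2) n +
     series (fun n => normc (b n) ^+ 2) n))).
    by apply: is_cvgM; [exact: is_cvg_cst | exact: is_cvgD].
  by apply/funext => n; rewrite /series/= -big_split/= mulr_sumr.
Qed.

Lemma sq_sum_le a n : square_summable a ->
  series (fun n => normc (a n) ^+ 2) n <=
  limn (series (fun n => normc (a n) ^+ 2)).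
Proof. by move=> sa; exact: (nondecreasing_cvgn_le (@nd_sq a) sa). Qed.

Lemma l2norm_coef a n : square_summable a -> normc (a n) <= l2norm a.
Proof.
move=> sa; rewrite -(ger0_norm (normc_ge0 (a n))) -sqrtr_sqr /l2norm.
rewrite ler_wsqrtr//; apply: le_trans (sq_sum_le n.+1 sa).
by rewrite /series/= big_nat_recr//= lerDr sumr_ge0.
Qed.

Lemma l2normZ c a : square_summable a ->
  l2norm (fun n => c * a n) = normc c * l2norm a.
Proof.
move=> sa; rewrite /l2norm.
rewrite (_ : series _ = (fun n => normc c ^+ 2 *
  series (fun n => normc (a n) ^+ 2) n)); last first.
  apply/funext => n; rewrite /series/= mulr_sumr.
  by apply: eq_bigr => i _; rewrite normcM exprMn.
rewrite limM//; last exact: is_cvg_cst.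
rewrite lim_cst// sqrtrM ?sqr_ge0// sqrtr_sqr ger0_norm ?normc_ge0//.
Qed.

Let minkowski_fin a b n :
  Num.sqrt (\sum_(0 <= k < n) normc (a k + b k) ^+ 2) <=
  Num.sqrt (\sum_(0 <= k < n) normc (a k) ^+ 2) +
  Num.sqrt (\sum_(0 <= k < n) normc (b k) ^+ 2).
Proof.
elim: n => [|n IH]; first by rewrite !big_nil sqrtr0 addr0.
rewrite !big_nat_recr//=.
set S := \sum_(0 <= k < n) normc (a k + b k) ^+ 2 in IH *.
set A := \sum_(0 <= k < n) normc (a k) ^+ 2 in IH *.
set B := \sum_(0 <= k < n) normc (b k) ^+ 2 in IH *.
have A0 : 0 <= A by apply: sumr_ge0 => i _; exact: sqr_ge0.
have B0 : 0 <= B by apply: sumr_ge0 => i _; exact: sqr_ge0.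
have S0 : 0 <= S by apply: sumr_ge0 => i _; exact: sqr_ge0.
have := @le_normcD R (Num.sqrt A +i* normc (a n)) (Num.sqrt B +i* normc (b n)).
rewrite /= !sqr_sqrtr//; apply: le_trans.
rewrite ler_wsqrtr// lerD//; last first.
  by rewrite lerXn2r ?nnegrE ?addr_ge0 ?normc_ge0// le_normcD.
by rewrite -[S]sqr_sqrtr// lerXn2r ?nnegrE ?addr_ge0 ?sqrtr_ge0.
Qed.

Lemma l2normD a b : square_summable a -> square_summable b ->
  l2norm (fun n => a n + b n) <= l2norm a + l2norm b.
Proof.
move=> sa sb; have sab := sq_sumD sa sb.
have ab0 : 0 <= l2norm a + l2norm b by rewrite addr_ge0// sqrtr_ge0.
rewrite -[leRHS]ger0_norm// -[leRHS]sqrtr_sqr /l2norm ler_wsqrtr//.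
apply: limr_le => //; apply: nearW => n.
rewrite -[leLHS]sqr_sqrtr; last by apply: sumr_ge0 => i _; exact: sqr_ge0.
rewrite lerXn2r ?nnegrE ?sqrtr_ge0//.
apply: (le_trans (minkowski_fin a b n)).
by rewrite lerD// ler_wsqrtr// sq_sum_le.
Qed.

End SquareSummable.

Section Uniqueness.
Variable R : realType.
Implicit Types (a b : nat -> R[i]) (z : R[i]) (h g : R[i] -> R[i]).

Let geo (x : R) m N : 0 <= x -> x <= 2^-1 -> (m <= N)%N ->
  \sum_(m <= n < N) x ^+ n <= 2 * x ^+ m - 2 * x ^+ N.
Proof.
move=> x0 x2; elim: N => [|N IH].
  by rewrite leqn0 => /eqP ->; rewrite big_geq// subrr.
rewrite leq_eqVlt => /predU1P[->|]; first by rewrite big_geq// subrr.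
rewrite ltnS => mN; rewrite big_nat_recr//=.
apply: (le_trans (lerD (IH mN) (lexx _))).
have := ler_wpM2l (exprn_ge0 N x0) x2; rewrite exprS; lra.
Qed.

Lemma normc_sum (I : Type) (r : seq I) (F : I -> R[i]) :
  normc (\sum_(i <- r) F i) <= \sum_(i <- r) normc (F i).
Proof.
elim/big_ind2: _ => [|x u y v xu yv|//].
  by rewrite /= expr0n/= addr0 sqrtr0.
by apply: le_trans (lerD xu yv); exact: le_normcD.
Qed.

Lemma normcX z n : normc (z ^+ n) = normc z ^+ n.
Proof.
elim: n => [|n IH]; last by rewrite !exprS normcM IH.
by rewrite !expr0 /= expr1n expr0n addr0 sqrtr1.
Qed.

Lemma normc_real (x : R) : 0 <= x -> normc x%:C = x.
Proof. by move=> x0; rewrite /= expr0n addr0 sqrtr_sqr ger0_norm. Qed.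

Lemma power_series_eq0 a : square_summable a ->
  (forall z, disk z -> series (fun n => a n * z ^+ n) @ \oo --> (0 : R[i])) ->
  forall n, a n = 0.
Proof.
move=> sa a0 m; move: (leqnn m); move: {2}m => p.
elim/ltn_ind: m p => m IH p _.
set t := normc (a m); pose B := l2norm a + 1.
have B0 : 0 < B by rewrite ltr_wpDl// sqrtr_ge0.
have aB n : normc (a n) <= B.
  by apply: (le_trans (l2norm_coef n sa)); rewrite lerDl.
have key (x : R) : 0 < x -> x <= 2^-1 -> t <= 3 * B * x.
  move=> x0 x2; have xd : disk (x%:C).
    by rewrite /disk/= normr_normc normc_real ?ltW// (ltcR x 1); lra.
  have Bx0 : 0 < B * x ^+ m.+1 by rewrite mulr_gt0// exprn_gt0.
  have /cvgrPdist_lt/(_ (B * x ^+ m.+1)%:C) := a0 _ xd.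
  rewrite (ltcR 0) => /(_ Bx0) [K _ HK].
  pose N := maxn K m.+1; have mN : (m.+1 <= N)%N by rewrite leq_maxr.
  have := HK N (leq_maxl _ _).
  rewrite /= sub0r normrN normr_normc ltcR /series/=.
  rewrite (@big_cat_nat _ _ _ m.+1)//= big_nat_recr//= big_nat big1 ?add0r.
    2:{ by move=> i /andP[_ im]; rewrite (IH i im i)// mul0r. }
  set T := \sum_(m.+1 <= i < N) _ => ST.
  have TB : normc T <= B * (2 * x ^+ m.+1).
    apply: (le_trans (normc_sum _ _)).
    apply: (@le_trans _ _ (B * \sum_(m.+1 <= n < N) x ^+ n)).
      rewrite mulr_sumr; apply: ler_sum => i _.
      rewrite normcM normcX normc_real; last exact: ltW.
      by apply: ler_wpM2r => //; rewrite exprn_ge0// ltW.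
    rewrite ler_pM2l//; apply: (le_trans (geo (ltW x0) x2 mN)).
    by rewrite gerBl mulr_ge0// exprn_ge0// ltW.
  have tx : t * x ^+ m <= 3 * B * x * x ^+ m.
    have -> : t * x ^+ m = normc (a m * x%:C ^+ m + T - T).
      by rewrite addrK normcM normcX normc_real// ltW.
    apply: (le_trans (le_normcD _ _)); rewrite normcN.
    by move: ST TB; rewrite exprS; lra.
  by move: tx; rewrite ler_pM2r// exprn_gt0.
apply: eq0_normc; apply/eqP; rewrite eq_le normc_ge0 andbT leNgt.
apply/negP; rewrite -/t => t0.
have B6 : 0 < 6 * B by rewrite mulr_gt0.
have := @key (Num.min 2^-1 (t / (6 * B))).
rewrite lt_min ge_min lexx/= invr_gt0 ltr0n/= divr_gt0// => /(_ isT isT).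
apply/negP; rewrite -ltNge; apply: (@le_lt_trans _ _ (3 * B * (t / (6 * B)))).
  by rewrite ler_pM2l ?mulr_gt0// ge_min lexx orbT.
rewrite (_ : 3 * B * (t / (6 * B)) = t / 2); first lra.
by field; rewrite gt_eqF.
Qed.

Lemma power_series_uniq a b h : square_summable a -> square_summable b ->
  power_series_on_disk a h -> power_series_on_disk b h -> a = b.
Proof.
move=> sa sb ha hb; apply/funext => n; apply/eqP; rewrite -subr_eq0; apply/eqP.
have sN : square_summable (fun n => a n + (-1) * b n).
  exact/sq_sumD/sq_sumZ.
rewrite -(@power_series_eq0 _ sN _ n); first by rewrite mulN1r.
move=> z zd; rewrite -(subrr (h z)).
rewrite (_ : series _ = series (fun n => a n * z ^+ n) -
                        series (fun n => b n * z ^+ n)).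
  by apply: cvgB; [exact: ha | exact: hb].
apply/funext => k; rewrite /series/= fctE -sumrB.
by apply: eq_bigr => i _; rewrite mulN1r mulrBl.
Qed.

End Uniqueness.

Section HardySpace.
Variable R : realType.
Implicit Types (a b : nat -> R[i]) (h g : R[i] -> R[i]).

Lemma power_seriesD a b h g : power_series_on_disk a h ->
  power_series_on_disk b g ->
  power_series_on_disk (fun n => a n + b n) (h + g).
Proof.
move=> ha hb z zd.
rewrite (_ : series _ = series (fun n => a n * z ^+ n) +
                        series (fun n => b n * z ^+ n)).
  by apply: cvgD; [exact: ha | exact: hb].
apply/funext => k; rewrite /series/= fctE -big_split/=.
by apply: eq_bigr => i _; rewrite mulrDl.
Qed.

Lemma power_seriesZ (c : R[i]) a h : power_series_on_disk a h ->
  power_series_on_disk (fun n => c * a n) (c *: h).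
Proof.
move=> ha z zd.
rewrite (_ : series _ = (fun k => c * series (fun n => a n * z ^+ n) k)).
  by apply: cvgM; [exact: cvg_cst | exact: ha].
apply/funext => k; rewrite /series/= mulr_sumr.
by apply: eq_bigr => i _; rewrite mulrA.
Qed.

Lemma H2_submod_closed : submod_closed (@H2pred R).
Proof.
split=> [|c h g].
  apply/asboolP; split=> [|//]; exists (fun=> 0); first exact: sq_sum0.
  move=> z zd; rewrite (_ : series _ = cst 0); first exact: cvg_cst.
  by apply/funext => n; rewrite /series/= big1// => i _; rewrite mul0r.
move=> /asboolP[[a sa ha] h0] /asboolP[[b sb hb] g0]; apply/asboolP; split.
  exists (fun n => c * a n + b n); first by apply/sq_sumD => //; exact/sq_sumZ.
  exact/power_seriesD/hb/power_seriesZ.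
by move=> z zd; rewrite !fctE h0// g0// addr0 scaler0.
Qed.

HB.instance Definition _ :=
  GRing.isSubmodClosed.Build R[i] (R[i] -> R[i]) (@H2pred R) H2_submod_closed.

Record H2 := MkH2 { H2fun :> R[i] -> R[i]; _ : H2fun \in @H2pred R }.

HB.instance Definition _ := [isSub for H2fun].
HB.instance Definition _ := [Choice of H2 by <:].
HB.instance Definition _ := [SubChoice_isSubLmodule of H2 by <:].

Lemma H2_coefs (h : H2) :
  exists a, square_summable a /\ power_series_on_disk a h.
Proof. by case: h => h /= /asboolP[[a sa ha] _]; exists a. Qed.

(* the Taylor coefficients of h at 0: unique by [power_series_uniq] *)
Definition H2coef (h : H2) : nat -> R[i] := projT1 (cid (H2_coefs h)).

Lemma H2coef_sq_sum (h : H2) : square_summable (H2coef h).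
Proof. by rewrite /H2coef; case: cid => a []. Qed.

Lemma H2coef_series (h : H2) : power_series_on_disk (H2coef h) h.
Proof. by rewrite /H2coef; case: cid => a []. Qed.

Arguments H2coef_sq_sum : clear implicits.
Arguments H2coef_series : clear implicits.

Lemma H2fun_out (h : H2) z : ~ disk z -> h z = 0.
Proof. by case: h => h /= /asboolP[_]; apply. Qed.

Lemma H2coefE (h : H2) a : square_summable a -> power_series_on_disk a h ->
  H2coef h = a.
Proof.
move=> sa.
exact: power_series_uniq (H2coef_sq_sum h) sa (H2coef_series h).
Qed.

Lemma H2coefD (h g : H2) : H2coef (h + g) = fun n => H2coef h n + H2coef g n.
Proof.
apply: H2coefE; first exact/sq_sumD/H2coef_sq_sum/H2coef_sq_sum.
by apply: power_seriesD; exact: H2coef_series.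
Qed.

Lemma H2coefZ (c : R[i]) (h : H2) : H2coef (c *: h) = fun n => c * H2coef h n.
Proof.
apply: H2coefE; first exact/sq_sumZ/H2coef_sq_sum.
by apply: power_seriesZ; exact: H2coef_series.
Qed.

Definition H2norm (h : H2) : R[i] := (l2norm (H2coef h))%:C.

Lemma ler_H2normD (h g : H2) : H2norm (h + g) <= H2norm h + H2norm g.
Proof.
rewrite /H2norm -rmorphD/= lecR H2coefD.
exact/l2normD/H2coef_sq_sum/H2coef_sq_sum.
Qed.

Lemma H2normZ (c : R[i]) (h : H2) : H2norm (c *: h) = `|c| * H2norm h.
Proof.
rewrite /H2norm H2coefZ l2normZ ?rmorphM/= ?normr_normc//.
exact: H2coef_sq_sum.
Qed.

Lemma H2norm0_eq0 (h : H2) : H2norm h = 0 -> h = 0.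
Proof.
move=> /(congr1 (@complex.Re R))/= h0; apply/val_inj/funext => z /=.
have [zd|zd] := pselect (disk z); last by rewrite H2fun_out.
have c0 n : H2coef h n = 0.
  apply: eq0_normc; apply/eqP; rewrite eq_le normc_ge0 andbT -h0.
  exact/l2norm_coef/H2coef_sq_sum.
apply: (@cvg_unique _ (@norm_hausdorff _ R[i])
  (series (fun n => H2coef h n * z ^+ n) @ \oo)).
  exact: H2coef_series.
rewrite (_ : series _ = cst 0); first exact: cvg_cst.
by apply/funext => n; rewrite /series/= big1// => i _; rewrite c0 mul0r.
Qed.

HB.instance Definition _ :=
  Lmodule_isNormed.Build R[i] H2 ler_H2normD H2normZ H2norm0_eq0.

Lemma Mz_subproof (h : H2) : (fun z => z * h z) \in @H2pred R.
Proof.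
apply/asboolP; split; last by move=> z zd; rewrite H2fun_out// mulr0.
have shift (V : zmodType) (u : nat -> V) n :
    series (fun n => if n is m.+1 then u m else 0) n.+1 = series u n.
  by rewrite /series/= big_nat_recl//= add0r.
exists (fun n => if n is m.+1 then H2coef h m else 0).
  have /cvg_ex[l hl] := H2coef_sq_sum h; apply/cvg_ex; exists l.
  rewrite -cvg_shiftS; apply: cvg_trans hl; apply: near_eq_cvg.
  apply: nearW => n; rewrite -shift.
  by apply: eq_bigr => -[_|//]; rewrite /= !expr0n/= addr0 sqrtr0 expr0n.
move=> z zd; rewrite -cvg_shiftS.
rewrite (_ : [sequence _]_n = (fun k =>
    z * series (fun n => H2coef h n * z ^+ n) k)).
  by apply: cvgM; [exact: cvg_cst | exact: H2coef_series].
apply/funext => k; rewrite -shift/= /series/= mulr_sumr.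
apply: eq_bigr => -[_|i _]; first by rewrite mul0r mulr0.
by rewrite exprS mulrCA.
Qed.

Definition Mz (h : H2) : H2 := MkH2 (Mz_subproof h).

End HardySpace.

Section Operators.
Variable R : realType.
Implicit Types (f phi : R[i] -> R[i]).

(* Only the values on the disk of the functions [f] and [phi] below matter. *)

Definition is_blaschke f : Prop :=
  exists (theta : R) (N : nat) (a : 'I_N -> R[i]),
    [/\ (1 <= N)%N, forall j, disk (a j) &
      forall z, disk z -> f z = (cos theta +i* sin theta) *
        \prod_(j < N) ((z - a j) / (1 - conjc (a j) * z))].

Definition is_Hinfty phi : Prop :=
  (forall z, disk z -> derivable phi z 1) /\ [bounded phi z | z in @disk R].

Definition sup_norm phi : R := sup [set rnorm (phi z) | z in @disk R].

Definition op_norm (A : H2 R -> H2 R) : R :=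
  sup [set rnorm (A h) | h in [set h : H2 R | `|h| <= 1]].

(* [M_ phi] and [C_ f] are defined on all functions on the disk; being
   functions on the disk, their values vanish off the disk. *)
Definition M_ phi (h : R[i] -> R[i]) : R[i] -> R[i] :=
  fun z => if `[< disk z >] then phi z * h z else 0.

Definition C_ f (h : R[i] -> R[i]) : R[i] -> R[i] :=
  fun z => if `[< disk z >] then h (f z) else 0.

End Operators.

(* Main.v *)
Require Import Defs.
From HB Require Import structures.
From mathcomp Require Import all_boot all_order all_algebra.
From mathcomp Require Import cyclic separable cyclotomic.
From mathcomp Require Import complex zify ring lra.
From mathcomp Require Import all_classical all_reals all_analysis.

Import Order.TTheory GRing.Theory Num.Theory.
Import numFieldNormedType.Exports.
Import ComplexField.Normc.

Local Open Scope classical_set_scope.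
Local Open Scope ring_scope.
Local Open Scope complex_scope.

(* Put phi = A 1.  For w in the disk, h - h(f w) = (z - f w) g with g in H^2, so
   the intertwining relation makes A (h - h(f w)) vanish at w, that is,
   (A h) w = phi w * h (f w).  Testing this on the Szego kernel of f w gives
     |phi w|^2 (1 - |w|^2) <= ||A||^2 (1 - |f w|^2).
   For a Blaschke product, (1 - |f w|^2) / (1 - |w|^2) is at most the sup norm
   of f' up to O(1 - |w|^2), so the maximum modulus principle for phi yields the
   bound on the whole disk. *)

(** Dually, the relation says that the adjoint of [A] sends the Szego kernel of w to an eigenvector
    of the adjoint shift, with eigenvalue the conjugate of f w, hence to a multiple of the kernel of
    f w. Division by z - f w inside H^2 expresses this without adjoints, and comparing the norms of
    the two kernels is the origin of the quotient (1 - |f w|^2) / (1 - |w|^2). By the Schwarz-Pick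
    lemma this quotient is at least |f' w| in the disk, so a bound on f' does not bound it directly;
    the two agree on the circle. This is why the error term appears and why the sharp constant has
    to be carried inward from the boundary. However, phi is at that point only an element of H^2,
    with no values on the circle. The maximum modulus principle is therefore stated for a bound on
    an annulus; it is reduced to Taylor polynomials on a circle inside the disk, and for polynomials
    averages over roots of unity replace the Cauchy integral. *)

Section ComplexModulus.
Variable R : realType.
Set Implicit Arguments.
Unset Strict Implicit.
Implicit Types (z w : R[i]).

(** * Complex limits and series in terms of the real modulus *)

Lemma diskE z : disk z <-> normc z < 1.
Proof. by rewrite /disk/= normr_normc (ltcR _ 1). Qed.

(** Comparable numbers in [R[i]] have equal imaginary parts, so every epsilon of its topology is
    real. *)
Lemma normc_pos_real (e : R[i]) : 0 < e -> e = (complex.Re e)%:C.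
Proof. by case: e => x y; rewrite ltcE/= => /andP[/eqP -> _]. Qed.

Lemma cvg_normcP (u : nat -> R[i]) l : u @ \oo --> l <->
  forall e : R, 0 < e -> exists N, forall n, (N <= n)%N -> normc (l - u n) < e.
Proof.
split=> [/cvgrPdist_lt ul e e0|ul].
  have [|N _ HN] := ul e%:C; first by rewrite (ltcR 0).
  by exists N => n /HN/=; rewrite normr_normc ltcR.
apply/cvgrPdist_lt => e e0; have eE := normc_pos_real e0.
have [|N HN] := ul (complex.Re e); first by rewrite eE (ltcR 0) in e0.
by exists N => // n /HN/=; rewrite normr_normc eE ltcR.
Qed.

Lemma normc_lim_le (u : nat -> R[i]) l (B : R) :
  u @ \oo --> l -> (forall n, normc (u n) <= B) -> normc l <= B.
Proof.
move=> /cvg_normcP ul uB; rewrite leNgt; apply/negP => Bl.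
have [|N /(_ N (leqnn _))] := ul (normc l - B); first by rewrite subr_gt0.
have := le_normcD (l - u N) (u N); rewrite subrK; have := uB N; lra.
Qed.

Lemma cvg_complex (x y : nat -> R) (a b : R) :
  x @ \oo --> a -> y @ \oo --> b ->
  (fun n => x n +i* y n) @ \oo --> a +i* b.
Proof.
move=> /cvgrPdist_lt xa /cvgrPdist_lt yb; apply/cvg_normcP => e e0.
have e2 : 0 < e / 2 by rewrite divr_gt0.
have [N1 _ H1] := xa _ e2; have [N2 _ H2] := yb _ e2.
exists (maxn N1 N2) => n; rewrite geq_max => /andP[/H1 n1 /H2 n2].
rewrite [X in normc X](_ : _ = (a - x n)%:C + 'i * (b - y n)%:C); last first.
  by simpc.
apply: (le_lt_trans (le_normcD _ _)); rewrite normcM.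
have nr (t : R) : normc t%:C = `|t| by rewrite /= expr0n addr0 sqrtr_sqr.
have -> : normc ('i : R[i]) = 1 by rewrite /= expr0n/= add0r expr1n sqrtr1.
rewrite !nr mul1r; move: n1 n2 => /=; lra.
Qed.

(** Real and imaginary parts are dominated by the modulus, so each part converges absolutely. *)
Lemma normc_series_cvg (u : nat -> R[i]) :
  cvgn (series (fun n => normc (u n))) -> cvgn (series u).
Proof.
move=> nu.
have part (p : R[i] -> R) : (forall z, `|p z| <= normc z) ->
    cvgn (series (fun n => p (u n))).
  move=> pn; apply: normed_cvg.
  by apply: series_le_cvg nu => n;
    [exact: normr_ge0|exact: normc_ge0|exact: pn].
have /cvg_ex[a ha] : cvgn (series (fun n => complex.Re (u n))).
  by apply: part => -[x y] /=; rewrite -sqrtr_sqr ler_wsqrtr// lerDl sqr_ge0.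
have /cvg_ex[b hb] : cvgn (series (fun n => complex.Im (u n))).
  by apply: part => -[x y] /=; rewrite -sqrtr_sqr ler_wsqrtr// lerDr sqr_ge0.
apply/cvg_ex; exists (a +i* b); apply: cvg_trans (cvg_complex ha hb).
apply: near_eq_cvg; apply: nearW => n; rewrite /series/=.
elim: n => [|n IH]; first by rewrite !big_nil.
by rewrite !big_nat_recr//= -IH; case: (u n) => p q; simpc.
Qed.

End ComplexModulus.

(** * Finite real sums: Cauchy-Schwarz and geometric sums *)

Section RealSums.
Variable R : realType.

Lemma cauchy_schwarz_sum (x y : nat -> R) n :
  (\sum_(0 <= k < n) x k * y k) ^+ 2 <=
  (\sum_(0 <= k < n) x k ^+ 2) * (\sum_(0 <= k < n) y k ^+ 2).
Proof.
elim: n => [|n IH]; first by rewrite !big_nil expr0n mul0r.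
rewrite !big_nat_recr//=.
set X := \sum_(0 <= k < n) x k * y k in IH *.
set A := \sum_(0 <= k < n) x k ^+ 2 in IH *.
set B := \sum_(0 <= k < n) y k ^+ 2 in IH *.
have A0 : 0 <= A by apply: sumr_ge0 => i _; exact: sqr_ge0.
have B0 : 0 <= B by apply: sumr_ge0 => i _; exact: sqr_ge0.
set a := x n; set b := y n.
clearbody X A B a b.
(* Only the cross term is left. By [IH] its square is at most 4 A B (a b)^2, which AM-GM bounds by
   (A b^2 + B a^2)^2. *)
suff : 2 * X * (a * b) <= A * b ^+ 2 + B * a ^+ 2 by nra.
have r0 : 0 <= A * b ^+ 2 + B * a ^+ 2.
  by rewrite addr_ge0 // mulr_ge0 // sqr_ge0.
apply: (le_trans (ler_norm _)); rewrite -[leRHS]ger0_norm// -ler_sqr ?nnegrE//.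
rewrite !real_normK ?num_real//.
have := ler_wpM2l (mulr_ge0 (ler0n R 4) (sqr_ge0 (a * b))) IH.
have := sqr_ge0 (A * b ^+ 2 - B * a ^+ 2); nra.
Qed.

Lemma geometric_sum (q : R) n :
  (\sum_(0 <= k < n) q ^+ k) * (1 - q) = 1 - q ^+ n.
Proof.
elim: n => [|n IH]; first by rewrite big_nil expr0 subrr mul0r.
by rewrite big_nat_recr//= mulrDl IH exprSr; ring.
Qed.

Lemma geometric_sum_le (q : R) n : 0 <= q < 1 ->
  \sum_(0 <= k < n) q ^+ k <= (1 - q)^-1.
Proof.
move=> /andP[q0 q1]; have q1' : 0 < 1 - q by rewrite subr_gt0.
rewrite -(ler_pM2r q1') geometric_sum mulVf ?gt_eqF// gerBl.
exact: exprn_ge0.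
Qed.

End RealSums.

(** * Functions in H^2: point evaluation, backward shift, division by z - w *)

Section HardyFunctions.
Variable R : realType.
Set Implicit Arguments.
Unset Strict Implicit.
Implicit Types (a : nat -> R[i]) (z w : R[i]) (h : H2 R) (B : R).

Lemma l2norm_ge0 a : 0 <= l2norm a. Proof. exact: sqrtr_ge0. Qed.

Lemma square_summable_bounded a B :
  (forall n, \sum_(0 <= k < n) normc (a k) ^+ 2 <= B) -> square_summable a.
Proof.
move=> aB; apply: nondecreasing_is_cvgn; first exact: nd_sq.
by exists B => _ [n _ <-]; exact: aB.
Qed.

Lemma l2norm_sum_le a n : square_summable a ->
  \sum_(0 <= k < n) normc (a k) ^+ 2 <= l2norm a ^+ 2.
Proof.
move=> sa; have := sq_sum_le n sa; rewrite /series/= => H.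
rewrite /l2norm sqr_sqrtr//; apply: le_trans H.
by apply: sumr_ge0 => i _; exact: sqr_ge0.
Qed.

Lemma l2norm_le a B : square_summable a -> 0 <= B ->
  (forall n, \sum_(0 <= k < n) normc (a k) ^+ 2 <= B ^+ 2) -> l2norm a <= B.
Proof.
move=> sa B0 aB; rewrite -[leRHS]ger0_norm// -[leRHS]sqrtr_sqr ler_wsqrtr//.
by apply: limr_le => //; apply: nearW => n; exact: aB.
Qed.

(** Cauchy-Schwarz against the powers of |z|. Both the convergence of the series in the disk and the
    bound on point evaluations come from it. *)
Lemma power_sum_le a z n : square_summable a -> normc z < 1 ->
  (\sum_(0 <= k < n) normc (a k * z ^+ k)) ^+ 2 <=
  l2norm a ^+ 2 / (1 - normc z ^+ 2).
Proof.
move=> sa z1; have z0 := normc_ge0 z.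
have q1 : 0 <= normc z ^+ 2 < 1.
  by rewrite sqr_ge0 /= expr_lt1.
rewrite (eq_bigr (fun k => normc (a k) * normc z ^+ k)); last first.
  by move=> k _; rewrite normcM normcX.
apply: (le_trans (cauchy_schwarz_sum _ _ _)).
apply: ler_pM; rewrite ?l2norm_sum_le//; try by
  apply: sumr_ge0 => i _; exact: sqr_ge0.
rewrite (eq_bigr (fun k => (normc z ^+ 2) ^+ k)) ?geometric_sum_le//.
by move=> k _; rewrite exprAC.
Qed.

Lemma power_series_cvg a z : square_summable a -> normc z < 1 ->
  cvgn (series (fun n => a n * z ^+ n)).
Proof.
move=> sa z1; apply: normc_series_cvg; apply: nondecreasing_is_cvgn.
  apply/nondecreasing_seqP => n.
  by rewrite /series/= big_nat_recr//= lerDl normc_ge0.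
exists (Num.sqrt (l2norm a ^+ 2 / (1 - normc z ^+ 2))) => _ [n _ <-].
rewrite -[leLHS]ger0_norm ?sumr_ge0// => [|i _]; last exact: normc_ge0.
by rewrite -sqrtr_sqr ler_wsqrtr// power_sum_le.
Qed.

Lemma H2_of_coefs a : square_summable a -> exists h, H2coef h = a.
Proof.
move=> sa.
pose f z := if `[< disk z >] then limn (series (fun n => a n * z ^+ n)) else 0.
have fa : power_series_on_disk a f.
  move=> z zd; rewrite /f asboolT//.
  by apply: power_series_cvg => //; exact/diskE.
have fH : f \in @H2pred R.
  apply/asboolP; split; first by exists a.
  by move=> z zd; rewrite /f asboolF.
by exists (MkH2 fH); exact: H2coefE.
Qed.

Lemma H2_ext h (g : H2 R) : (forall z, normc z < 1 -> h z = g z) -> h = g.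
Proof.
move=> hg; apply/val_inj/funext => z /=.
have [/diskE/hg//|zd] := pselect (disk z).
by rewrite !H2fun_out.
Qed.

(** The norm of [H2] has values in [R[i]]; in [R] the order is total and square roots are at
    hand. *)
Definition H2nrm h : R := l2norm (H2coef h).

Lemma H2nrm_ge0 h : 0 <= H2nrm h. Proof. exact: l2norm_ge0. Qed.

Lemma H2nrmE h : `|h| = (H2nrm h)%:C. Proof. by []. Qed.

Lemma H2coef_series_at h z : normc z < 1 ->
  series (fun n => H2coef h n * z ^+ n) @ \oo --> h z.
Proof. by move=> z1; apply: H2coef_series; apply/diskE. Qed.

(** Evaluation at z has norm (1 - |z|^2)^(-1/2); [szego_kernel] shows that the constant is sharp. *)
Lemma H2_eval_le h z : normc z < 1 ->
  normc (h z) ^+ 2 * (1 - normc z ^+ 2) <= H2nrm h ^+ 2.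
Proof.
move=> z1; have z0 := normc_ge0 z.
have q1 : 0 < 1 - normc z ^+ 2 by rewrite subr_gt0 expr_lt1.
rewrite -ler_pdivlMr//.
set B := H2nrm h ^+ 2 / _.
have B0 : 0 <= B by rewrite divr_ge0 ?sqr_ge0// ltW.
rewrite -[leRHS]sqr_sqrtr// lerXn2r ?nnegrE ?normc_ge0 ?sqrtr_ge0//.
apply: (normc_lim_le (@H2coef_series_at h z z1)) => n.
apply: (le_trans (normc_sum _ _)).
rewrite -[leLHS]ger0_norm ?sumr_ge0// => [|i _]; last exact: normc_ge0.
by rewrite -sqrtr_sqr ler_wsqrtr// power_sum_le//; exact: H2coef_sq_sum.
Qed.

(** A single constant serves the whole ball, so it controls all the Taylor remainders [shiftn h n]
    at once. It is positive because it later serves as a divisor. *)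
Lemma H2_eval_bound B (r : R) : r < 1 -> exists2 b : R, 0 < b &
  forall h, H2nrm h <= B -> forall z, normc z <= r -> normc (h z) <= b.
Proof.
move=> r1; pose c := Num.sqrt (B ^+ 2 / (1 - r ^+ 2)).
exists (c + 1); first by rewrite ltr_wpDl ?sqrtr_ge0.
move=> h hB z zr; have z0 := normc_ge0 z; have r0 := le_trans z0 zr.
apply: (@le_trans _ _ c); last by rewrite lerDl.
have q0 : 0 < 1 - r ^+ 2 by rewrite subr_gt0 expr_lt1.
rewrite -[leLHS]ger0_norm ?normc_ge0// -sqrtr_sqr ler_wsqrtr// ler_pdivlMr//.
apply: (@le_trans _ _ (normc (h z) ^+ 2 * (1 - normc z ^+ 2))).
  rewrite ler_wpM2l ?sqr_ge0// lerD2l lerN2.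
  by apply: lerXn2r; rewrite ?nnegrE.
apply: (le_trans (H2_eval_le h (le_lt_trans zr r1))).
apply: lerXn2r (hB); rewrite nnegrE; first exact: H2nrm_ge0.
exact: le_trans (H2nrm_ge0 h) hB.
Qed.

Lemma H2_const_subproof : exists h, forall z, normc z < 1 -> h z = 1.
Proof.
have s1 : square_summable (fun n => if n is 0%N then 1 : R[i] else 0).
  apply: (@square_summable_bounded _ 1) => -[|n]; first by rewrite big_nil.
  rewrite big_nat_recl//= big1 ?addr0 => [|i _].
    by rewrite expr0n/= expr1n addr0 sqrtr1 expr1n.
  by rewrite expr0n/= addr0 sqrtr0 expr0n.
have [h hE] := H2_of_coefs s1; exists h => z z1.
have := @H2coef_series_at h z z1; rewrite -cvg_shiftS => hz.
apply: (@cvg_unique _ (@norm_hausdorff _ R[i]) _ _ _ _ hz).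
rewrite (_ : [sequence _]_n = cst 1); first exact: cvg_cst.
apply/funext => n; rewrite /series/= big_nat_recl//= hE mulr1 big1 ?addr0//.
by move=> i _; rewrite mul0r.
Qed.

Definition H2one : H2 R := projT1 (cid H2_const_subproof).

Lemma H2oneE z : normc z < 1 -> H2one z = 1.
Proof. by rewrite /H2one; case: cid => h /= ; apply. Qed.

Lemma sum_sq_shift_le a n :
  \sum_(0 <= k < n) normc (a k.+1) ^+ 2 <=
  \sum_(0 <= k < n.+1) normc (a k) ^+ 2.
Proof. by rewrite big_nat_recl//= lerDr sqr_ge0. Qed.

Lemma backward_shift_subproof h : exists g, H2coef g = fun n => H2coef h n.+1.
Proof.
apply: H2_of_coefs; apply: (@square_summable_bounded _ (H2nrm h ^+ 2)) => n.
apply: le_trans (l2norm_sum_le n.+1 (@H2coef_sq_sum _ h)).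
exact: sum_sq_shift_le.
Qed.

(** The function (h - h(0)) / z, that is, the adjoint of [Mz] applied to [h]. *)
Definition backward_shift h : H2 R := projT1 (cid (backward_shift_subproof h)).

Lemma backward_shift_coef h n : H2coef (backward_shift h) n = H2coef h n.+1.
Proof. by rewrite /backward_shift; case: cid => g /= ->. Qed.

Lemma backward_shift_nrm h : H2nrm (backward_shift h) <= H2nrm h.
Proof.
apply: l2norm_le; [exact: H2coef_sq_sum|exact: H2nrm_ge0|move=> n].
apply: le_trans (l2norm_sum_le n.+1 (@H2coef_sq_sum _ h)).
under eq_bigr do rewrite backward_shift_coef.
exact: sum_sq_shift_le.
Qed.

Lemma backward_shiftE h z : normc z < 1 ->
  h z = H2coef h 0 + z * backward_shift h z.
Proof.
move=> z1; have := @H2coef_series_at h z z1; rewrite -cvg_shiftS => hz.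
apply: (@cvg_unique _ (@norm_hausdorff _ R[i]) _ _ _ _ hz).
rewrite (_ : [sequence _]_n = (fun n => H2coef h 0 + z *
    series (fun n => H2coef (backward_shift h) n * z ^+ n) n)).
  apply: cvgD; first exact: cvg_cst.
  by apply: cvgM; [exact: cvg_cst|exact: H2coef_series_at].
apply/funext => n; rewrite /series/= big_nat_recl//= mulr1 mulr_sumr.
congr (_ + _); apply: eq_bigr => i _.
by rewrite backward_shift_coef exprS mulrCA.
Qed.

(** The Taylor remainder of order n, divided by z^n. *)
Definition shiftn h n := iter n backward_shift h.

Lemma shiftn_nrm h n : H2nrm (shiftn h n) <= H2nrm h.
Proof.
elim: n => [//|n IH]; exact: (le_trans (backward_shift_nrm _)).
Qed.

Lemma shiftn_coef h n k : H2coef (shiftn h n) k = H2coef h (n + k).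
Proof.
elim: n k => [//|n IH] k.
by rewrite /shiftn iterS backward_shift_coef IH addSnnS.
Qed.

Lemma shiftn_rec h n z : normc z < 1 ->
  shiftn h n z = H2coef h n + z * shiftn h n.+1 z.
Proof. by move=> z1; rewrite backward_shiftE// shiftn_coef addn0. Qed.

Lemma shiftnE h n z : normc z < 1 ->
  h z = \sum_(0 <= k < n) H2coef h k * z ^+ k + z ^+ n * shiftn h n z.
Proof.
move=> z1; elim: n => [|n {1}->]; first by rewrite big_nil add0r mul1r.
by rewrite big_nat_recr//= shiftn_rec// exprSr; ring.
Qed.

(** The n-th coefficient of (h - h w) / (z - w) is the sum of a_k w^(k-n-1) over k > n, which is
    [shiftn h n.+1 w]. The work is to show that this sequence is square summable. *)
Lemma H2_div h w : normc w < 1 ->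
  exists g : H2 R, forall z, normc z < 1 -> h z - h w = (z - w) * g z.
Proof.
move=> w1; have w0 := normc_ge0 w.
pose G n := shiftn h n w; pose t := normc w.
have Grec n : G n = H2coef h n + w * G n.+1 by exact: shiftn_rec.
pose B := H2nrm h ^+ 2 / (1 - t ^+ 2).
have q1 : 0 < 1 - t ^+ 2 by rewrite subr_gt0 expr_lt1.
have t1 : 0 < 1 - t by rewrite subr_gt0.
have GB n : normc (G n) ^+ 2 <= B.
  rewrite /B ler_pdivlMr//; apply: (le_trans (H2_eval_le (shiftn h n) w1)).
  apply: lerXn2r; [exact: H2nrm_ge0|exact: H2nrm_ge0|exact: shiftn_nrm].
(* Convexity of the square, applied to c + t y = (1 - t) (c / (1 - t)) + t y. *)
have step n : normc (G n) ^+ 2 <=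
    normc (H2coef h n) ^+ 2 / (1 - t) + t * normc (G n.+1) ^+ 2.
  set c := normc (H2coef h n); set y := normc (G n.+1).
  have : normc (G n) <= c + t * y.
    by rewrite Grec; apply: (le_trans (le_normcD _ _)); rewrite normcM.
  move=> le1; apply: (@le_trans _ _ ((c + t * y) ^+ 2)).
    by rewrite lerXn2r ?nnegrE ?addr_ge0 ?mulr_ge0 ?normc_ge0.
  rewrite -subr_ge0.
  rewrite (_ : _ - _ = t / (1 - t) * (c - (1 - t) * y) ^+ 2).
    by rewrite mulr_ge0 ?sqr_ge0// divr_ge0// ltW.
  by field; rewrite gt_eqF.
(* Summing [step] gives S <= K + t (S + B), where B pays for the term added by the index shift. As t
   < 1, this yields S + B <= (K + B) / (1 - t). *)
have sG : square_summable (fun n => G n.+1).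
  pose K := H2nrm h ^+ 2 / (1 - t).
  apply: (@square_summable_bounded _ ((K + B) / (1 - t))) => n.
  apply: (@le_trans _ _ (\sum_(0 <= k < n) normc (G k) ^+ 2 + B)).
    apply: (@le_trans _ _ (\sum_(0 <= k < n.+1) normc (G k) ^+ 2)).
      exact: sum_sq_shift_le.
    by rewrite big_nat_recr//= lerD2l.
  set S := \sum_(0 <= k < n) _.
  have SS : S <= K + t * (S + B).
    apply: (le_trans (ler_sum _ (fun k _ => step k))).
    rewrite big_split/= -mulr_suml -mulr_sumr lerD//.
      by rewrite ler_pM2r ?invr_gt0// l2norm_sum_le//; exact: H2coef_sq_sum.
    rewrite ler_wpM2l//.
    apply: (@le_trans _ _ (\sum_(0 <= k < n.+1) normc (G k) ^+ 2)).
      exact: sum_sq_shift_le.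
    by rewrite big_nat_recr//= lerD2l.
  by rewrite ler_pdivlMr//; nra.
have [g gE] := H2_of_coefs sG; exists g => z z1.
have gz : (fun n => (z - w) * series (fun n => G n.+1 * z ^+ n) n) @ \oo -->
    (z - w) * g z.
  apply: cvgM; first exact: cvg_cst.
  by have := @H2coef_series_at g z z1; rewrite gE.
apply/esym/(@cvg_unique _ (@norm_hausdorff _ R[i]) _ _ _ _ gz).
(* The recurrence [Grec] makes the product telescope; the remainder z^n [G n] tends to 0 because [G]
   is bounded. *)
have part n : (z - w) * series (fun n => G n.+1 * z ^+ n) n =
    series (fun n => H2coef h n * z ^+ n) n - h w + z ^+ n * G n.
  rewrite /series/=; elim: n => [|n IH].
    by rewrite !big_nil mulr0 mul1r /G /shiftn/= add0r addNr.
  by rewrite !big_nat_recr//= mulrDr IH exprS Grec; ring.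
rewrite (_ : (fun n => _) = (fun n => series (fun n => H2coef h n * z ^+ n) n -
  h w + z ^+ n * G n)); last by apply/funext.
rewrite -[h z - h w]addr0.
apply: cvgD; first by apply: cvgB; [exact: H2coef_series_at|exact: cvg_cst].
have /cvg_normcP zG : (fun n => z ^+ n) @ \oo --> (0 : R[i]).
  apply/cvg_normcP => e e0.
  have z1' : `|normc z| < 1 by rewrite ger0_norm ?normc_ge0.
  have /cvgrPdist_lt/(_ _ e0)[N _ HN] := cvg_expr z1'.
  exists N => n /HN; rewrite !sub0r normrN normcN normcX.
  by rewrite ger0_norm// exprn_ge0// normc_ge0.
apply/cvg_normcP => e e0.
pose b := Num.sqrt B + 1.
have b0 : 0 < b by rewrite ltr_wpDl ?sqrtr_ge0.
have [|N HN] := zG (e / b); first by rewrite divr_gt0.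
exists N => n /HN; rewrite !sub0r !normcN normcM => zn.
apply: (@le_lt_trans _ _ (normc (z ^+ n) * b)); last by rewrite -ltr_pdivlMr.
rewrite ler_wpM2l ?normc_ge0// (@le_trans _ _ (Num.sqrt B)) ?lerDl//.
by rewrite -[leLHS]ger0_norm ?normc_ge0// -sqrtr_sqr ler_wsqrtr.
Qed.

End HardyFunctions.

(** * The maximum modulus principle, from polynomials to H^2 *)

Section MaximumModulus.
Variable R : realType.
Set Implicit Arguments.
Unset Strict Implicit.
Implicit Types (z w : R[i]) (h : H2 R) (p : {poly R[i]}) (S C : R).

(** The polynomial X^n - 1 splits and, in characteristic 0, is separable; its n distinct roots
    include a primitive one. *)
Lemma closed_prim_root_exists (C : numClosedFieldType) n : (0 < n)%N ->
  exists z : C, n.-primitive_root z.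
Proof.
pose p : {poly C} := 'X^n - 1; have [r Dp] := closed_field_poly_normal p.
move=> n_gt0; rewrite (monicP _) ?monicXnsubC // scale1r in Dp.
have rn1 : all n.-unity_root r by apply/allP=> z; rewrite -root_prod_XsubC -Dp.
have sz_r : (n < (size r).+1)%N.
  by rewrite -(size_prod_XsubC r id) -Dp size_XnsubC.
have [|z] := hasP (has_prim_root n_gt0 rn1 _ sz_r); last by exists z.
by rewrite -separable_prod_XsubC -Dp separable_Xn_sub_1 // pnatr_eq0 -lt0n.
Qed.

Lemma normc_unity_root N z : (0 < N)%N -> z ^+ N = 1 -> normc z = 1.
Proof.
move=> N0 /(congr1 (@normc R)); rewrite normcX normc1 => /eqP.
by rewrite pexpr_eq1 ?normc_ge0// => /eqP.
Qed.

Lemma sum_prim_root N (x : R[i]) j : N.-primitive_root x ->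
  \sum_(k < N) (x ^+ j) ^+ k = if (N %| j)%N then N%:R else 0.
Proof.
move=> px; rewrite (prim_order_dvd px).
have [->|x1] := eqVneq (x ^+ j) 1.
  rewrite (eq_bigr (fun=> 1)) => [|k _]; last by rewrite expr1n.
  by rewrite sumr_const card_ord.
apply/eqP; have : x ^+ j - 1 != 0 by rewrite subr_eq0.
move/mulfI/inj_eq <-; rewrite -subrX1 mulr0 exprAC (prim_expr_order px).
by rewrite expr1n subrr.
Qed.

(** A discrete Cauchy estimate: the n-th coefficient is the average of p(x) x^(-n) over the N-th
    roots of unity, with x^(N-n) in the place of x^(-n). *)
Lemma poly_coef_le p S : (forall z, normc z = 1 -> normc p.[z] <= S) ->
  forall n, normc p`_n <= S.
Proof.
(* This N exceeds n and every index of a coefficient of p, so j = n is the only j < N for which N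
   divides j + (N - n). *)
move=> pS n; pose N := (size p + n.+1)%N.
have N0 : (0 < N)%N by rewrite /N addnS.
have nN : (n < N)%N by rewrite /N addnS ltnS leq_addl.
have [x px] := closed_prim_root_exists R[i] N0.
have x1 k : normc (x ^+ k) = 1.
  by rewrite normcX (normc_unity_root N0 (prim_expr_order px)) expr1n.
have avg : \sum_(k < N) p.[x ^+ k] * x ^+ (k * (N - n)) = N%:R * p`_n.
  rewrite (eq_bigr (fun k : 'I_N =>
    \sum_(j < N) p`_j * (x ^+ (j + (N - n))) ^+ k)); last first.
    move=> k _; rewrite (horner_coef_wide _ (leq_addr n.+1 _)) mulr_suml.
    apply: eq_bigr => j _; rewrite -mulrA -!exprM -exprD; congr (_ * x ^+ _).
    by rewrite -mulnDr mulnC.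
  rewrite exchange_big/= (bigD1 (Ordinal nN))//= [X in _ + X]big1 ?addr0.
    by rewrite -mulr_sumr (sum_prim_root _ px) subnKC ?(ltnW nN)// dvdnn mulrC.
  move=> j; rewrite -val_eqE/= => jn; rewrite -mulr_sumr (sum_prim_root _ px).
  case: ifP => [|_]; last by rewrite mulr0.
  move=> /dvdnP[q qE]; exfalso; have jN := ltn_ord j; clearbody N.
  case: q qE => [|[|q]]; rewrite ?mulSn; move/eqP: jn; nia.
have N0' : (0 : R) < N%:R by rewrite ltr0n.
rewrite -(ler_pM2l N0').
have -> : N%:R * normc p`_n = normc (N%:R * p`_n).
  rewrite normcM; congr (_ * _).
  by rewrite -[N%:R in RHS](rmorph_nat (real_complex R)) normc_real ?ler0n.
rewrite -avg; apply: (le_trans (normc_sum _ _)).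
apply: (@le_trans _ _ (\sum_(k < N) S)).
  by apply: ler_sum => k _; rewrite normcM x1 mulr1 pS// x1.
by rewrite sumr_const card_ord mulr_natl.
Qed.

Lemma poly_disk_le_geometric p S w :
  (forall z, normc z = 1 -> normc p.[z] <= S) -> normc w < 1 ->
  normc p.[w] <= S / (1 - normc w).
Proof.
move=> pS w1; have S0 : 0 <= S.
  by apply: le_trans (normc_ge0 _) (pS 1 _); rewrite normc1.
rewrite horner_coef -(big_mkord xpredT (fun i => p`_i * w ^+ i)).
apply: (le_trans (normc_sum _ _)).
apply: (@le_trans _ _ (\sum_(0 <= i < size p) S * normc w ^+ i)).
  apply: ler_sum => i _.
  rewrite normcM normcX ler_wpM2r ?exprn_ge0 ?normc_ge0//.
  exact: poly_coef_le.
rewrite -mulr_sumr ler_wpM2l// geometric_sum_le//.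
by rewrite normc_ge0.
Qed.

(* The constant lost in [poly_disk_le_geometric] disappears on taking m-th
   roots of the estimate for the powers [p ^+ m]. *)
Lemma poly_max_modulus_unit p S w :
  (forall z, normc z = 1 -> normc p.[z] <= S) -> normc w < 1 ->
  normc p.[w] <= S.
Proof.
move=> pS w1; set v := normc p.[w]; rewrite leNgt; apply/negP => Sv.
have S0 : 0 <= S.
  by apply: le_trans (normc_ge0 _) (pS 1 _); rewrite normc1.
have v0 : 0 < v by exact: le_lt_trans Sv.
have t0 : 0 < 1 - normc w by rewrite subr_gt0.
have Sv1 : `|S / v| < 1.
  by rewrite ger0_norm ?divr_ge0 ?(ltW v0)// ltr_pdivrMr// mul1r.
have /cvgrPdist_lt/(_ _ t0)[m _ /(_ m (leqnn m))] := cvg_expr Sv1.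
rewrite sub0r normrN ger0_norm ?exprn_ge0 ?divr_ge0 ?(ltW v0)//.
apply/negP; rewrite -leNgt expr_div_n ler_pdivlMr ?exprn_gt0// mulrC.
rewrite -ler_pdivlMr// /v -normcX -horner_exp.
apply: poly_disk_le_geometric => // z z1.
by rewrite horner_exp normcX lerXn2r ?nnegrE ?normc_ge0// pS.
Qed.

Lemma poly_max_modulus p S (r : R) w : 0 < r ->
  (forall z, normc z = r -> normc p.[z] <= S) -> normc w < r ->
  normc p.[w] <= S.
Proof.
move=> r0 pS wr; have rn : normc r%:C = r by rewrite normc_real// ltW.
have rC0 : r%:C != 0.
  by rewrite -(rmorph0 (real_complex R)) (inj_eq (@complexI R)) gt_eqF.
have wE : w = r%:C * (r%:C^-1 * w) by rewrite mulrA mulfV// mul1r.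
have := @poly_max_modulus_unit (p \Po (r%:C *: 'X)) S (r%:C^-1 * w).
rewrite horner_comp hornerZ hornerX -wE; apply.
  by move=> z z1; rewrite horner_comp hornerZ hornerX pS// normcM rn z1 mulr1.
by rewrite normcM normcV rn ltr_pdivrMl// mulr1.
Qed.

(** On a circle that lies in the annulus and encloses w, h is within e/2 of a Taylor polynomial. The
    polynomial case then applies, and e/2 is paid twice: on the circle and at w. *)
Lemma H2_max_modulus h C r0 : r0 < 1 ->
  (forall z, r0 < normc z < 1 -> normc (h z) <= C) ->
  forall w, normc w < 1 -> normc (h w) <= C.
Proof.
move=> r01 hC w w1; apply/ler_addgt0Pr => e e0.
pose r := (1 + Num.max r0 (normc w)) / 2.
have m1 : Num.max r0 (normc w) < 1 by rewrite gt_max r01.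
have mr : Num.max r0 (normc w) < r by rewrite /r; lra.
have r1 : r < 1 by rewrite /r; lra.
have [r0r wr] : r0 < r /\ normc w < r by move: mr; rewrite gt_max => /andP[].
have rp : 0 < r by apply: le_lt_trans wr; exact: normc_ge0.
have [b b0 hb'] := @H2_eval_bound _ (H2nrm h) _ r1.
have hb n z : normc z <= r -> normc (shiftn h n z) <= b.
  by apply: hb'; exact: shiftn_nrm.
have r1' : `|r| < 1 by rewrite ger0_norm// ltW.
have eb0 : 0 < e / 2 / b by rewrite !divr_gt0.
have /cvgrPdist_lt/(_ _ eb0)[n _ /(_ n (leqnn n))] := cvg_expr r1'.
rewrite sub0r normrN ger0_norm ?exprn_ge0 ?(ltW rp)// ltr_pdivlMr// => rn.
pose p := \poly_(i < n) H2coef h i.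
have pE z : normc z < 1 -> h z = p.[z] + z ^+ n * shiftn h n z.
  by move=> z1; rewrite (shiftnE h n z1) horner_poly big_mkord.
have tail z : normc z <= r -> normc (z ^+ n * shiftn h n z) <= e / 2.
  move=> zr; rewrite normcM normcX; apply: le_trans (ltW rn).
  apply: ler_pM; [by rewrite exprn_ge0 ?normc_ge0|exact: normc_ge0| |exact: hb].
  by apply: lerXn2r; rewrite ?nnegrE ?normc_ge0 ?(ltW rp).
have pw : normc p.[w] <= C + e / 2.
  apply: (poly_max_modulus rp) => // z zr.
  have z1 : normc z < 1 by rewrite zr.
  have -> : p.[z] = h z + - (z ^+ n * shiftn h n z) by rewrite pE// addrK.
  apply: (le_trans (le_normcD _ _)); rewrite normcN lerD ?tail ?zr//.
  by apply: hC; rewrite z1 zr r0r.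
rewrite pE//; apply: (le_trans (le_normcD _ _)).
by have := tail w (ltW wr); lra.
Qed.

End MaximumModulus.

(** * Finite Blaschke products near the unit circle *)

Section BlaschkeProducts.
Variable R : realType.
Set Implicit Arguments.
Unset Strict Implicit.
Implicit Types (a z w d : R[i]) (f g : R[i] -> R[i]) (s C : R).

(* The intended [s] is the sum of (1 - |a_j|^2) / |1 - conj(a_j) w|^2, which
   equals w g'(w) / g(w) on the unit circle; multiplying by [g w] keeps the last
   estimate free of poles at the zeros of g and stable under products. *)
Definition blaschke_bounds g := exists C, forall w, normc w < 1 ->
  exists d s, [/\ is_derive w 1 g d,
    normc d <= C /\ 0 <= s <= C,
    normc (g w) <= 1,
    1 - normc (g w) ^+ 2 <= (1 - normc w ^+ 2) * s &
    normc (w * d - g w * s%:C) <= C * (1 - normc w ^+ 2)].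

Lemma blaschke_bounds_cst c : normc c = 1 -> blaschke_bounds (cst c).
Proof.
move=> c1; exists 0 => w w1; exists 0, 0; split.
- exact: is_derive_cst.
- by rewrite normc0 !lexx.
- by rewrite /cst c1.
- by rewrite /cst c1 expr1n subrr mulr0.
- by rewrite /cst !mulr0 subrr normc0 mul0r.
Qed.

(** The quantities [s] add like logarithmic derivatives. The gap is subadditive since 1 - |f g|^2 =
    (1 - |f|^2) + |f|^2 (1 - |g|^2), and the product rule multiplies each error by a factor of
    modulus at most 1. *)
Lemma blaschke_boundsM f g : blaschke_bounds f -> blaschke_bounds g ->
  blaschke_bounds (f * g).
Proof.
move=> [C1 H1] [C2 H2]; exists (C1 + C2) => w w1.
have [d1 [s1 [D1 [N1 /andP[s10 S1]] f1 M1 E1]]] := H1 w w1.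
have [d2 [s2 [D2 [N2 /andP[s20 S2]] g1 M2 E2]]] := H2 w w1.
have w0 := normc_ge0 w; have f0 := normc_ge0 (f w); have g0 := normc_ge0 (g w).
have q0 : 0 <= 1 - normc w ^+ 2 by rewrite subr_ge0 expr_le1// ltW.
have C20 := le_trans s20 S2; have C10 := le_trans s10 S1.
have part (x y : R) (u v : R[i]) (b : R) : normc u <= 1 -> normc v <= b ->
    normc (u * v) <= b.
  move=> u1 vb; rewrite normcM; apply: le_trans vb.
  by rewrite ler_piMl ?normc_ge0.
exists (f w *: d2 + g w *: d1), (s1 + s2); split.
- exact: is_deriveM.
- split; last by rewrite addr_ge0// lerD.
  by apply: (le_trans (le_normcD _ _)); rewrite addrC lerD// part.
- by rewrite normcM mulr_ile1.
- rewrite normcM exprMn.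
  have fle : normc (f w) ^+ 2 <= 1 by rewrite expr_le1.
  have fge := sqr_ge0 (normc (f w)).
  have := ler_wpM2l fge M2; set F := normc (f w) ^+ 2 in M1 fle fge *.
  set G := normc (g w) ^+ 2 in M2 *; set Q := 1 - normc w ^+ 2 in q0 M1 M2 *.
  have : F * (Q * s2) <= Q * s2 by rewrite ler_piMl// mulr_ge0.
  by nra.
- have -> : w * (f w *: d2 + g w *: d1) - (f * g) w * (s1 + s2)%:C =
      f w * (w * d2 - g w * s2%:C) + g w * (w * d1 - f w * s1%:C).
    by rewrite rmorphD /GRing.scale/= -[(f * g) w]/(f w * g w); ring.
  apply: (le_trans (le_normcD _ _)); rewrite addrC mulrDl.
  by rewrite lerD// part.
Qed.

Lemma normc_mulJ z : (normc z ^+ 2)%:C = z * conjc z.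
Proof. by rewrite -sqr_normc normr_normc rmorphXn. Qed.

Lemma normc_conj z : normc (conjc z) = normc z.
Proof. by case: z => x y /=; rewrite sqrrN. Qed.

Lemma blaschke_factor_identity a w :
  normc (1 - conjc a * w) ^+ 2 - normc (w - a) ^+ 2 =
  (1 - normc a ^+ 2) * (1 - normc w ^+ 2).
Proof.
apply: complexI; rewrite rmorphM !rmorphB/= !normc_mulJ.
by rewrite !rmorphB !rmorphM !rmorph1/= conjcK; ring.
Qed.

Lemma blaschke_denom_ge a w : normc a < 1 -> normc w < 1 ->
  1 - normc a <= normc (1 - conjc a * w).
Proof.
move=> a1 w1; have := le_normcD (1 - conjc a * w) (conjc a * w).
rewrite subrK normc1 normcM normc_conj.
have : normc a * normc w <= normc a by rewrite ler_piMr ?normc_ge0// ltW.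
lra.
Qed.

Lemma is_derive_blaschke_factor a w : 1 - conjc a * w != 0 ->
  is_derive w 1 (fun z => (z - a) / (1 - conjc a * z))
    ((1 - normc a ^+ 2)%:C / (1 - conjc a * w) ^+ 2).
Proof.
move=> D0; have dD : is_derive w 1 (fun z => 1 - conjc a * z) (- conjc a).
  have := is_deriveB (is_derive_cst (1 : R[i]) w (1 : R[i]))
    (is_deriveZ (conjc a) (is_derive_id w (1 : R[i]))).
  by move/is_derive_eq; apply; rewrite sub0r /GRing.scale/= mulr1.
have dV : is_derive w 1 (fun z => (1 - conjc a * z)^-1)
    (- (1 - conjc a * w) ^- 2 *: - conjc a).
  apply: DeriveDef; first by apply: derivableV => //; case: dD.
  by rewrite deriveV// ?derive_val//; case: dD.
have dN : is_derive w 1 (fun z => z - a) (1 : R[i]).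
  have := is_deriveB (is_derive_id w (1 : R[i])) (is_derive_cst a w (1 : R[i])).
  by move/is_derive_eq; apply; rewrite subr0.
have := is_deriveM dN dV; move/is_derive_eq; apply.
rewrite rmorphB/= normc_mulJ /GRing.scale/=.
by field.
Qed.

(** With D = 1 - conj(a) w, the last error equals a (1 - |a|^2) (1 - |w|^2) / (D^2 conj(D)). The
    exponent 3 in [C] counts these denominators, each of modulus at least 1 - |a|. *)
Lemma blaschke_bounds_factor a : normc a < 1 ->
  blaschke_bounds (fun z => (z - a) / (1 - conjc a * z)).
Proof.
move=> a1; have a0 := normc_ge0 a; pose C := (1 - normc a) ^- 3.
exists C => w w1; have w0 := normc_ge0 w.
set D := 1 - conjc a * w.
have Dge : 1 - normc a <= normc D by exact: blaschke_denom_ge.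
have t0 : 0 < 1 - normc a by rewrite subr_gt0.
have n0 : 0 < normc D by exact: lt_le_trans Dge.
have D0 : D != 0 by apply: contraTneq n0 => ->; rewrite normc0 ltxx.
have id1 := blaschke_factor_identity a w; rewrite -/D in id1.
have q0 : 0 <= 1 - normc w ^+ 2 by rewrite subr_ge0 expr_le1// ltW.
have p0 : 0 <= 1 - normc a ^+ 2 by rewrite subr_ge0 expr_le1// ltW.
have p1 : 1 - normc a ^+ 2 <= 1 by rewrite gerBl sqr_ge0.
have D3 : (normc D) ^- 3 <= C.
  by rewrite lef_pV2 ?posrE ?exprn_gt0// lerXn2r ?nnegrE ?(ltW t0) ?(ltW n0).
have D2 : (1 - normc a ^+ 2) / normc D ^+ 2 <= C.
  apply: (@le_trans _ _ (1 / (1 - normc a) ^+ 2)).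
    apply: ler_pM; rewrite ?invr_ge0 ?sqr_ge0//.
    by rewrite lef_pV2 ?posrE ?exprn_gt0// lerXn2r ?nnegrE ?(ltW t0) ?(ltW n0).
  rewrite mul1r /C lef_pV2 ?posrE ?exprn_gt0// exprS.
  by rewrite ler_piMl ?sqr_ge0// gerBl.
exists ((1 - normc a ^+ 2)%:C / D ^+ 2), ((1 - normc a ^+ 2) / normc D ^+ 2).
have nE : normc ((w - a) / D) ^+ 2 = normc (w - a) ^+ 2 / normc D ^+ 2.
  by rewrite normcM normcV exprMn exprVn.
have gap : 1 - normc ((w - a) / D) ^+ 2 =
    (1 - normc w ^+ 2) * ((1 - normc a ^+ 2) / normc D ^+ 2).
  rewrite nE mulrA [(1 - normc w ^+ 2) * _]mulrC -id1.
  by rewrite mulrBl divff// gt_eqF// exprn_gt0.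
split.
- exact: is_derive_blaschke_factor.
- by rewrite D2 divr_ge0 ?sqr_ge0// normcM normc_real// normcV normcX.
- rewrite -(@expr_le1 _ 2)//; last exact: normc_ge0.
  rewrite -subr_ge0 gap mulr_ge0// divr_ge0// sqr_ge0//.
- by rewrite gap.
- have DJ : conjc D != 0 by rewrite conjc_eq0.
  rewrite (_ : _ - _ = a * (1 - normc a ^+ 2)%:C * (1 - normc w ^+ 2)%:C /
      (D ^+ 2 * conjc D)).
    rewrite normcM normcV [normc (D ^+ 2 * _)]normcM normcX normc_conj -exprSr.
    rewrite !normcM !normc_real//.
    rewrite mulrC mulrA ler_wpM2r//.
    apply: le_trans D3; rewrite ler_piMr ?invr_ge0 ?exprn_ge0 ?normc_ge0//.
    by rewrite mulr_ile1// ltW.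
  have DJE : conjc D = 1 - a * conjc w.
    by rewrite /D rmorphB rmorphM rmorph1/= conjcK.
  rewrite rmorphM fmorphV/= [(normc D ^+ 2)%:C]normc_mulJ DJE.
  rewrite !rmorphB/= !normc_mulJ !rmorph1.
  rewrite DJE in DJ; move: D0 DJ; rewrite /D => D0 DJ.
  by field; rewrite D0 DJ.
Qed.

Lemma blaschke_bounds_prod N (a : 'I_N -> R[i]) :
  (forall j, normc (a j) < 1) ->
  blaschke_bounds (fun z => \prod_(j < N) ((z - a j) / (1 - conjc (a j) * z))).
Proof.
elim: N a => [|N IH] a a1.
  rewrite (_ : (fun _ => _) = cst 1).
    by apply: blaschke_bounds_cst; rewrite normc1.
  by apply/funext => z; rewrite big_ord0.
rewrite (_ : (fun _ => _) =
  (fun z => \prod_(j < N) ((z - a (widen_ord (leqnSn N) j)) /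
      (1 - conjc (a (widen_ord (leqnSn N) j)) * z))) *
  (fun z => (z - a ord_max) / (1 - conjc (a ord_max) * z))).
  by apply: blaschke_boundsM; [exact: IH|exact: blaschke_bounds_factor].
by apply/funext => z; rewrite big_ord_recr.
Qed.

Lemma blaschke_factor_lt1 a w : normc a < 1 -> normc w < 1 ->
  normc ((w - a) / (1 - conjc a * w)) < 1.
Proof.
move=> a1 w1; have n0 : 0 < normc (1 - conjc a * w).
  by apply: lt_le_trans (blaschke_denom_ge a1 w1); rewrite subr_gt0.
rewrite normcM normcV ltr_pdivrMr// mul1r.
rewrite -ltr_sqr ?nnegrE ?normc_ge0// -subr_gt0 blaschke_factor_identity.
by rewrite mulr_gt0// subr_gt0 expr_lt1// normc_ge0.
Qed.

Lemma near_disk w : normc w < 1 -> \forall z \near w, normc z < 1.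
Proof.
move=> w1; apply/nbhs_ballP; exists (1 - normc w)%:C => /=.
  by rewrite (ltcR 0) subr_gt0.
move=> z; rewrite /ball/= normr_normc ltcR => wz.
have := le_normcD (- (w - z)) w; rewrite normcN opprB subrK => le1.
by apply: (le_lt_trans le1); rewrite -ltrBrDr.
Qed.

(** [is_blaschke] prescribes f only on the disk; since the disk is open, derivatives carry over. *)
Lemma blaschke_bounds_eq f g : (forall z, normc z < 1 -> f z = g z) ->
  blaschke_bounds f -> blaschke_bounds g.
Proof.
move=> fg [C H]; exists C => w w1; have [d [s]] := H w w1.
rewrite fg// => -[D N g1 M E]; exists d, s; split => //.
by apply: near_eq_is_derive D; near do apply: fg; exact: near_disk.
Unshelve. all: by end_near. Qed.

Lemma is_blaschke_bounds f : is_blaschke f ->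
  blaschke_bounds f /\ forall w, normc w < 1 -> normc (f w) < 1.
Proof.
move=> [theta [N [a [N1 aD fE]]]]; have a1 j : normc (a j) < 1 by exact/diskE.
have c1 : normc (cos theta +i* sin theta) = 1.
  by rewrite /= cos2Dsin2 sqrtr1.
split.
  apply: blaschke_bounds_eq
    (blaschke_boundsM (blaschke_bounds_cst c1) (blaschke_bounds_prod a1)).
  by move=> z /diskE zd; rewrite fE.
move=> w w1; rewrite fE; last exact/diskE.
(* Strictness comes from one factor, available because N >= 1; the remaining product only has
   modulus at most 1. *)
rewrite normcM c1 mul1r; case: N N1 a aD fE a1 => // N _ a _ _ a1.
rewrite big_ord_recr/= normcM.
have [C /(_ w w1)[d [s [_ _ P1 _ _]]]] :=
  @blaschke_bounds_prod N (fun j => a (widen_ord (leqnSn N) j)) (fun j => a1 _).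
have := @blaschke_factor_lt1 (a ord_max) w (a1 _) w1.
apply: le_lt_trans; rewrite ler_piMl ?normc_ge0//.
Qed.

End BlaschkeProducts.

(** * Intertwining operators and the bound on their multiplier *)

Section Intertwiner.
Variable R : realType.
Set Implicit Arguments.
Unset Strict Implicit.
Implicit Types (z w d : R[i]) (f : R[i] -> R[i]) (h : H2 R) (C : R).

(** Dividing twice by the increment u shows that the difference quotient differs from g z by u k(z +
    u), with k bounded near z. *)
Lemma H2_derivable h z : normc z < 1 -> derivable (h : R[i] -> R[i]) z 1.
Proof.
move=> z1; have [g gE] := H2_div h z1; have [k kE] := H2_div g z1.
have z0 := normc_ge0 z.
pose r := (1 + normc z) / 2.
have [zr r1] : normc z < r /\ r < 1 by rewrite /r; split; lra.
have [b b0 kb'] := @H2_eval_bound _ (H2nrm k) _ r1.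
have kb := kb' k (lexx _).
apply/cvg_ex; exists (g z); apply/cvgrPdist_lt => e e0.
have eE := normc_pos_real e0; have e0' : 0 < complex.Re e.
  by rewrite eE (ltcR 0) in e0.
pose d := Num.min (r - normc z) (complex.Re e / b).
have d0 : 0 < d by rewrite lt_min subr_gt0 zr divr_gt0.
apply/nbhs_ballP; exists d%:C => /=; first by rewrite (ltcR 0).
move=> u; rewrite /ball/= sub0r normrN normr_normc ltcR lt_min.
move=> /andP[ur ue] u0.
have uz1 : normc (u + z) <= r.
  by apply: (le_trans (le_normcD _ _)); lra.
rewrite [u *: 1]mulr1 gE ?(le_lt_trans uz1)// addrK /GRing.scale/= mulrA.
rewrite mulVf// mul1r -normrN opprB kE ?(le_lt_trans uz1)// addrK.
rewrite normr_normc eE ltcR normcM.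
apply: (@le_lt_trans _ _ (normc u * b)); last by rewrite -ltr_pdivlMr.
by rewrite ler_wpM2l ?normc_ge0// kb.
Qed.

(** The supremum is informative only once its set is known to be bounded above; the constant from
    [linear_boundedP] shows this, and also settles the case of norm 0, where rescaling to the unit
    ball is impossible. *)
Lemma op_normP (A : {linear H2 R -> H2 R}) : bounded_near A (nbhs (0 : H2 R)) ->
  0 <= op_norm A /\ forall h, H2nrm (A h) <= op_norm A * H2nrm h.
Proof.
move=> /linear_boundedP/pinfty_ex_gt0[c c0 Ac].
have cE := normc_pos_real c0; set c' := complex.Re c in cE.
have Ac' h : H2nrm (A h) <= c' * H2nrm h.
  by have := Ac h; rewrite !H2nrmE cE -rmorphM lecR.
have c'0 : 0 < c' by rewrite cE (ltcR 0) in c0.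
set X := [set rnorm (A h) | h in [set h : H2 R | `|h| <= 1]].
have Xle h : `|h| <= 1 -> H2nrm (A h) <= op_norm A.
  move=> h1; apply: (@ub_le_sup _ X); last by exists h.
  exists c' => _ [g g1 <-]; apply: (le_trans (Ac' g)).
  rewrite ler_piMr ?(ltW c'0)//.
  by move: g1; rewrite /= H2nrmE (lecR _ 1).
have A0 : 0 <= op_norm A.
  by apply: le_trans (Xle 0 _); [exact: H2nrm_ge0|rewrite normr0].
split=> // h; have := H2nrm_ge0 h; rewrite le_eqVlt => /predU1P[h0|h0].
  by have := Ac' h; rewrite -h0 !mulr0.
have hn : normc ((H2nrm h)^-1%:C) = (H2nrm h)^-1.
  by rewrite normc_real// invr_ge0 ltW.
have nZ (g : H2 R) (t : R[i]) : H2nrm (t *: g) = normc t * H2nrm g.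
  by apply: complexI; rewrite -H2nrmE normrZ normr_normc rmorphM.
have AZ : A ((H2nrm h)^-1%:C *: h) = (H2nrm h)^-1%:C *: A h by exact: linearZ.
have h1 : `|(H2nrm h)^-1%:C *: h| <= 1.
  by rewrite normrZ H2nrmE normr_normc hn -rmorphM mulVf ?gt_eqF.
by have := Xle _ h1; rewrite AZ nZ hn mulrC ler_pdivrMr.
Qed.

Lemma intertwinerE (A : {linear H2 R -> H2 R}) f :
  (forall w, normc w < 1 -> normc (f w) < 1) ->
  (forall h, M_ f (A h) = A (Mz h)) ->
  forall h w, normc w < 1 -> A h w = A (H2one R) w * h (f w).
Proof.
move=> f1 fA h w w1; have fw1 := f1 w w1; have [g gE] := H2_div h fw1.
have hE : h = h (f w) *: H2one R + Mz g - f w *: g.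
  apply: H2_ext => z z1.
  change (h z = h (f w) * H2one R z + z * g z - f w * g z).
  by rewrite H2oneE// mulr1 -addrA -mulrBl -gE// addrC subrK.
have -> : A h = h (f w) *: A (H2one R) + A (Mz g) - f w *: A g.
  by rewrite {1}hE linearB linearD !linearZ.
change (h (f w) * A (H2one R) w + A (Mz g) w - f w * A g w =
  A (H2one R) w * h (f w)).
by rewrite -fA /M_ asboolT ?addrK 1?mulrC//; exact/diskE.
Qed.

(** The witness is 1 / (1 - conj(w) z), with coefficients [conjc w ^+ n]. Its norm and its value at
    w both reduce to the geometric series of ratio |w|^2. *)
Lemma szego_kernel w : normc w < 1 -> exists h : H2 R,
  H2nrm h ^+ 2 <= (1 - normc w ^+ 2)^-1 /\ h w = (1 - normc w ^+ 2)^-1%:C.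
Proof.
move=> w1; have w0 := normc_ge0 w; set q := (_)^-1.
have t1 : 0 <= normc w ^+ 2 < 1 by rewrite sqr_ge0 expr_lt1.
have q0 : 0 < q by rewrite invr_gt0 subr_gt0; case/andP: t1.
have sq n : \sum_(0 <= k < n) normc (conjc w ^+ k) ^+ 2 <= q.
  apply: le_trans (geometric_sum_le n t1); apply: ler_sum => k _.
  by rewrite normcX normc_conj exprAC.
have sk := square_summable_bounded sq.
have [h hE] := H2_of_coefs sk; exists h; split.
  rewrite -[q]sqr_sqrtr ?(ltW q0)//.
  apply: lerXn2r; rewrite ?nnegrE ?sqrtr_ge0//.
  rewrite /H2nrm hE; apply: l2norm_le => // n.
  by rewrite sqr_sqrtr ?(ltW q0).
have := @H2coef_series_at _ h w w1; rewrite hE => hw.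
apply: (@cvg_unique _ (@norm_hausdorff _ R[i]) _ _ _ _ hw).
have t1' : `|normc w ^+ 2| < 1 by rewrite ger0_norm ?sqr_ge0//; case/andP: t1.
have geo := cvg_geometric_series (a := 1) t1'.
have geoC := cvg_complex geo (@cvg_cst _ (0 : R) _ \oo _).
rewrite mul1r in geoC.
suff -> : series (fun n => conjc w ^+ n * w ^+ n) =
    (fun n => series (geometric 1 (normc w ^+ 2)) n +i* cst 0 n) by exact: geoC.
apply/funext => n; rewrite /series/= complexr0 rmorph_sum/=.
by apply: eq_bigr => k _; rewrite mul1r rmorphXn/= normc_mulJ exprMn mulrC.
Qed.

Lemma intertwiner_multiplier_le (A : {linear H2 R -> H2 R}) f :
  bounded_near A (nbhs (0 : H2 R)) ->
  (forall w, normc w < 1 -> normc (f w) < 1) ->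
  (forall h, M_ f (A h) = A (Mz h)) ->
  forall w, normc w < 1 ->
  normc (A (H2one R) w) ^+ 2 * (1 - normc w ^+ 2) <=
  op_norm A ^+ 2 * (1 - normc (f w) ^+ 2).
Proof.
move=> /op_normP[A0 Ale] f1 fA w w1; have fw1 := f1 w w1.
have [h [hn hf]] := szego_kernel fw1.
have q0 : 0 < 1 - normc (f w) ^+ 2 by rewrite subr_gt0 expr_lt1// normc_ge0.
have := H2_eval_le (A h) w1.
rewrite (intertwinerE f1 fA)// hf normcM normc_real ?invr_ge0 ?(ltW q0)//.
set q := 1 - normc (f w) ^+ 2 in q0 hn *; set P := normc (A _ _) => le1.
have le2 : H2nrm (A h) ^+ 2 <= op_norm A ^+ 2 * q^-1.
  apply: (@le_trans _ _ ((op_norm A * H2nrm h) ^+ 2)).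
    apply: lerXn2r; last exact: Ale; rewrite nnegrE; first exact: H2nrm_ge0.
    by rewrite mulr_ge0// H2nrm_ge0.
  by rewrite exprMn ler_wpM2l ?sqr_ge0.
have := le_trans le1 le2; rewrite exprMn mulrAC -[q^-1 ^+ 2]mulr1 exprVn => le3.
have := ler_wpM2r (sqr_ge0 q) le3.
rewrite (_ : _ * q ^+ 2 = P ^+ 2 * (1 - normc w ^+ 2)); last first.
  by field; rewrite gt_eqF.
by rewrite (_ : _ / q * q ^+ 2 = op_norm A ^+ 2 * q)//; field; rewrite gt_eqF.
Qed.

Lemma sup_norm_ge f C : (forall w, normc w < 1 -> normc (f w) <= C) ->
  forall w, normc w < 1 -> normc (f w) <= sup_norm f.
Proof.
move=> fC w w1; apply: ub_le_sup; last first.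
  by exists w; [exact/diskE|rewrite /rnorm normr_normc].
by exists C => _ [z /diskE z1 <-]; rewrite /rnorm normr_normc; exact: fC.
Qed.

Lemma sup_norm_le f C : (forall w, normc w < 1 -> normc (f w) <= C) ->
  sup_norm f <= C.
Proof.
move=> fC; apply: ge_sup.
  by exists (rnorm (f 0)), 0 => //; apply/diskE; rewrite normc0 ltr01.
by move=> _ [z /diskE z1 <-]; rewrite /rnorm normr_normc; exact: fC.
Qed.

(** Since w d - f(w) s is small, the sup norm of f' controls |f(w)| s rather than s: up to C (1 -
    |w|^2), |f(w)| s is at most |w d|. The missing part (1 - |f(w)|) s is at most (1 - |w|^2) s^2 <=
    C^2 (1 - |w|^2). Hence K = C + C^2. *)
Lemma blaschke_quotient_le f : blaschke_bounds f ->
  0 <= sup_norm (derive1 f) /\ exists2 K, 0 <= K & forall w, normc w < 1 ->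
  1 - normc (f w) ^+ 2 <=
    (1 - normc w ^+ 2) * (sup_norm (derive1 f) + K * (1 - normc w ^+ 2)).
Proof.
move=> [C H]; have df w : normc w < 1 -> normc (derive1 f w) <= C.
  move=> w1; have [d [s [D [N _] _ _ _]]] := H w w1.
  by rewrite derive1E derive_val.
set M := sup_norm _; have M0 : 0 <= M.
  have d0 : normc (0 : R[i]) < 1 by rewrite normc0.
  exact: le_trans (normc_ge0 _) (sup_norm_ge df d0).
split=> //; exists (C + C ^+ 2).
  have [|d [s [_ [_ /andP[s0 sC]] _ _ _]]] := H 0; first by rewrite normc0.
  by rewrite addr_ge0 ?sqr_ge0 ?(le_trans s0).
move=> w w1; have [d [s [D [N /andP[s0 sC]] f1 E1 E2]]] := H w w1.
have w0 := normc_ge0 w; have f0 := normc_ge0 (f w).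
have dM : normc d <= M.
  have := sup_norm_ge df w1; rewrite derive1E.
  by rewrite (@derive_val _ _ _ _ _ _ _ D).
have q0 : 0 <= 1 - normc w ^+ 2 by rewrite subr_ge0 expr_le1// ltW.
apply: (le_trans E1); rewrite ler_wpM2l//.
have fs : normc (f w) * s <= M + C * (1 - normc w ^+ 2).
  have -> : normc (f w) * s = normc (w * d - (w * d - f w * s%:C)).
    by rewrite opprB addrC subrK normcM normc_real.
  apply: (le_trans (le_normcD _ _)); rewrite normcN lerD//.
  by rewrite normcM; apply: le_trans dM; rewrite ler_piMl ?normc_ge0// ltW.
have ff : 1 - normc (f w) <= (1 - normc w ^+ 2) * s.
  apply: le_trans E1; rewrite lerD2l lerN2 expr2 ler_piMl//.
set Q := 1 - normc w ^+ 2 in q0 E1 E2 fs ff *; set F := normc (f w) in fs ff *.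
have h1 := ler_wpM2r s0 ff.
have h2 : Q * s * s <= C ^+ 2 * Q.
  rewrite -mulrA mulrC ler_wpM2r// expr2; apply: ler_pM => //.
by move: h1 h2; rewrite mulrBl mul1r; lra.
Qed.

Lemma intertwiner_multiplier_sup (A : {linear H2 R -> H2 R}) f :
  bounded_near A (nbhs (0 : H2 R)) -> is_blaschke f ->
  (forall h, M_ f (A h) = A (Mz h)) ->
  forall w, normc w < 1 -> normc (A (H2one R) w) <=
    op_norm A * Num.sqrt (sup_norm (derive1 f)).
Proof.
move=> Ab /is_blaschke_bounds[fb f1] fA.
have [A0 _] := op_normP Ab; set a := op_norm A in A0 *.
have [] := blaschke_quotient_le fb.
set M := sup_norm _ => M0 [K K0 MK].
have phi_le w : normc w < 1 ->
    normc (A (H2one R) w) ^+ 2 <= a ^+ 2 * (M + K * (1 - normc w ^+ 2)).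
  move=> w1; have q0 : 0 < 1 - normc w ^+ 2.
    by rewrite subr_gt0 expr_lt1// normc_ge0.
  rewrite -(ler_pM2r q0).
  apply: (le_trans (intertwiner_multiplier_le Ab f1 fA w1)).
  by rewrite -/a -[leRHS]mulrA ler_wpM2l ?sqr_ge0// mulrC MK.
have step e w : 0 < e -> normc w < 1 ->
    normc (A (H2one R) w) ^+ 2 <= a ^+ 2 * (M + e).
  move=> e0 w1; have Me : 0 <= M + e by rewrite addr_ge0// ltW.
  have B0 : 0 <= a ^+ 2 * (M + e) by rewrite mulr_ge0 ?sqr_ge0.
  rewrite -[leRHS]sqr_sqrtr//; apply: lerXn2r.
  - by rewrite nnegrE normc_ge0.
  - by rewrite nnegrE sqrtr_ge0.
  (* On the annulus 1 - |z| < e / (2 (K + 1)), the error K (1 - |z|^2) <= 2 K (1 - |z|) is at most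
     e. Using K + 1 avoids division by 0. *)
  have K1 : 0 < 2 * (K + 1) by rewrite mulr_gt0// ltr_wpDl.
  have r1 : 1 - e / (2 * (K + 1)) < 1 by rewrite gtrBl divr_gt0.
  apply: (H2_max_modulus r1) => // z /andP[rz z1].
  rewrite -[leLHS]ger0_norm ?normc_ge0// -sqrtr_sqr ler_wsqrtr//.
  apply: (le_trans (phi_le z z1)); rewrite ler_wpM2l ?sqr_ge0// lerD2l.
  have z0 := normc_ge0 z.
  have : 1 - normc z < e / (2 * (K + 1)) by lra.
  rewrite ltr_pdivlMr// => le1.
  by rewrite (_ : 1 - normc z ^+ 2 = (1 - normc z) * (1 + normc z)); [nra|ring].
move=> w w1; rewrite -[leLHS]ger0_norm ?normc_ge0// -sqrtr_sqr.
rewrite -[a]ger0_norm// -[`|a|]sqrtr_sqr -sqrtrM ?sqr_ge0// ler_wsqrtr//.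
apply/ler_addgt0Pr => e e0.
(* The choice e / (a^2 + 1) makes the excess a^2 e / (a^2 + 1) at most e, even for a = 0. *)
have a1 : 0 < a ^+ 2 + 1 by rewrite ltr_wpDl ?sqr_ge0.
apply: (le_trans (step (e / (a ^+ 2 + 1)) w _ w1)); first by rewrite divr_gt0.
rewrite mulrDr lerD2l mulrA ler_pdivrMr// mulrC mulrDr mulr1 lerDl ltW//.
Qed.

End Intertwiner.

Theorem theoremC (R : realType) (f : R[i] -> R[i])
    (A : {linear H2 R -> H2 R}) :
  is_blaschke f ->
  bounded_near A (nbhs (0 : H2 R)) ->
  (forall h : H2 R, M_ f (A h) = A (Mz h)) ->
  exists phi : R[i] -> R[i],
    [/\ is_Hinfty phi,
        forall h : H2 R, A h = M_ phi (C_ f h) :> (R[i] -> R[i]) &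
        sup_norm phi <= op_norm A * Num.sqrt (sup_norm (derive1 f))].
Proof.
move=> fB Ab fA; have phi_le := intertwiner_multiplier_sup Ab fB fA.
have [_ f1] := is_blaschke_bounds fB.
exists (A (H2one R)); split.
- split=> [z /diskE z1|]; first exact: H2_derivable.
  apply/ex_bound.
    by apply: (@globally_properfilter _ _ 0); apply/diskE; rewrite normc0.
  exists (op_norm A * Num.sqrt (sup_norm (derive1 f)))%:C.
  by move=> z /diskE z1; rewrite /= normr_normc lecR phi_le.
- move=> h; apply/funext => z; rewrite /M_ /C_; case: asboolP => [/diskE z1|zd].
    exact: intertwinerE.
  (* Off the disk both sides vanish by the encoding of functions on the disk. *)
  exact: H2fun_out.
- exact: sup_norm_le.
Qed.
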